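(* Let $\epsilon>0$ be an arbitrarily small real number. Then there exists a Toeplitz sequence $\mathbf{b}=(b_n)_{n\in\mathbb{Z}}$ such that (1) the dynamical system $(X_{\mathbf{b}},\sigma)$ has (topological) entropy zero; (2) $$\limsup_{N\to\infty}\frac{1}{N}\left|\sum_{n=1}^{N} b_{n^2}\,\mu(n)\right|>\frac{6}{\pi^2}-\epsilon .$$
   Context: $\mathbb{N}=\{1,2,3,\dots\}$. The Möbius function $\mu:\mathbb{N}\to\{-1,0,1\}$ is given by $\mu(1)=1$, $\mu(n)=(-1)^k$ if $n$ is a product of $k$ distinct primes, and $\mu(n)=0$ otherwise. Let $S$ be a finite alphabet (here a finite set of numbers, $S\subset\mathbb{R}$). $S^{\mathbb{Z}}$ carries the product topology (discrete on $S$), and the shift $\sigma:S^{\mathbb{Z}}\to S^{\mathbb{Z}}$ is $(\sigma\mathbf{x})_n=x_{n+1}$. For $\mathbf{x}\in S^{\mathbb{Z}}$, $X_{\mathbf{x}}$ denotes the closure of the orbit $\{\sigma^n\mathbf{x}:n\in\mathbb{Z}\}$; $(X_{\mathbf{x}},\sigma)$ is a subshift. A point $x$ of a topological dynamical system $(X,T)$ is regularly recurrent if for every open neighborhood $U$ of $x$ there is $l_U\in\mathbb{N}$ with $l_U\mathbb{Z}\subset\{n\in\mathbb{Z}:T^nx\in U\}$. A Toeplitz sequence is a regularly recurrent point $\mathbf{b}\in S^{\mathbb{Z}}$ for the shift $\sigma$, for some finite alphabet $S$. The topological entropy of a subshift $(X,\sigma)$ is $\lim_{n\to\infty}\frac{\log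 p_X(n)}{n}$, where $p_X(n)$ is the number of distinct words of length $n$ occurring in elements of $X$. *)

(* Defs.v *)
From mathcomp Require Import all_boot all_order all_algebra finmap.
From mathcomp Require Import all_classical all_reals all_analysis.

Set Implicit Arguments.
Unset Strict Implicit.
Unset Printing Implicit Defensive.

Import Order.TTheory GRing.Theory Num.Theory.
Import numFieldNormedType.Exports.

Local Open Scope classical_set_scope.
Local Open Scope ring_scope.

(* A natural number is a product of distinct primes iff it equals the product
   of its prime divisors; this fails for n = 0, so that moebius 0 = 0. *)
Definition moebius (n : nat) : int :=
  if n == (\prod_(p <- primes n) p)%N then (-1) ^+ size (primes n) else 0.

(* T^n for n in Z, where Tinv is the inverse of T. *)
Definition iterz (X : Type) (T Tinv : X -> X) (n : int) (x : X) : X :=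
  match n with
  | Posz k => iter k T x
  | Negz k => iter k.+1 Tinv x
  end.

Definition regularly_recurrent (X : topologicalType) (T Tinv : X -> X)
    (x : X) : Prop :=
  forall U : set X, open U -> U x ->
    exists2 l : nat, (0 < l)%N &
      [set l%:Z * k | k in [set: int]] `<=` [set n | U (iterz T Tinv n x)].

Section Subshifts.
Variable A : finType.

(* A^Z with the product of the discrete topologies. *)
Definition biseq : Type := {ptws int -> discrete_topology A}.

Definition bishift (x : biseq) : biseq := fun n => x (n + 1).
Definition bishift_inv (x : biseq) : biseq := fun n => x (n - 1).

Lemma bishiftK : cancel bishift bishift_inv.
Proof. by move=> x; apply/funext => n; rewrite /bishift_inv /bishift subrK. Qed.

Lemma bishift_invK : cancel bishift_inv bishift.
Proof. by move=> x; apply/funext => n; rewrite /bishift_inv /bishift addrK. Qed.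

Definition orbit_closure (x : biseq) : set biseq :=
  closure [set iterz bishift bishift_inv n x | n in [set: int]].

Definition toeplitz (x : biseq) : Prop := regularly_recurrent bishift bishift_inv x.

Definition occurs_in (n : nat) (w : n.-tuple A) (x : biseq) : Prop :=
  exists i : int, forall k : 'I_n, tnth w k = x (i + k%:Z).

Definition complexity (X : set biseq) (n : nat) : nat :=
  #|[set w : n.-tuple A | `[< exists2 x, X x & occurs_in w x >]]%SET|.

(* A relation rather than a value of lim, which is a junk value on divergent
   sequences. *)
Definition has_entropy (R : realType) (X : set biseq) (h : R) : Prop :=
  (ln (complexity X n)%:R / n%:R : R) @[n --> \oo] --> h.

End Subshifts.

(* Main.v *)
Require Import Defs.
From mathcomp Require Import all_boot all_order all_algebra finmap.
From mathcomp Require Import all_classical all_reals all_analysis.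
From mathcomp Require Import zify ring lra.

Import Order.TTheory GRing.Theory Num.Theory.
Import numFieldNormedType.Exports.

Local Open Scope classical_set_scope.
Local Open Scope ring_scope.

Set Implicit Arguments.
Unset Strict Implicit.
Unset Printing Implicit Defensive.

(** Squares are sparse, so a sequence can carry the values of the Moebius
    function on its squares while remaining almost trivial elsewhere.

    Let [g] be the function on the integers with [g (n ^ 2) = mu n] and [g = 0]
    off the squares.  Choose scales [N_0 < P_0 <= N_1 < P_1 <= ...] where each
    is much larger than the previous ones and the [P_k] are prime, and put
    [W_k = N_k ^ 2 + N_k].  The block of [g] between [-W_k] and [W_k] is copied around
    every multiple of [P_k]; where copies overlap, the smallest [k] wins.  The
    resulting sequence is [block_seq].

    - It is Toeplitz ([toeplitz_block_seq]): which copies of index at most [k]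
      cover a position depends only on the position modulo [P_0 ... P_k].

    - It has entropy zero ([has_entropy0_block_seq]).  The logarithm of the
      number of words is subadditive in their length, so it is enough to count
      words of length [N_k].  Positions filled at a stage below [k] are
      determined by the position of the word modulo
      [P_0 ... P_(k-1) <= N_k].  The other nonzero letters all come from one
      copy of one block: a copy of index at least [k] extends by at least
      [N_k] beyond its last square, so a window of length [N_k] that meets one
      of its nonzero entries lies inside it ([block_window]).  Hence these letters
      sit at the squares of an interval of length [N_k], and there are about
      [sqrt N_k] of them at most.  This gives [exp (O(sqrt N_k log N_k))] words.

    - For most [n <= N_k] the letter at [n ^ 2] is [mu n].  Indeed [n ^ 2] is
      covered by a copy of index [k], with the right value, and it can only be
      spoiled by a smaller index [j].  Since [P_j] is prime, each of the
      [2 W_j + 1] residues in the block has at most two square roots modulo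
      [P_j], so stage [j] spoils a proportion of at most about [4 W_j / P_j] of
      the [n <= N_k] ([count_near_multiple]).

    The sum up to [N_k] is therefore close to the number of squarefree [n <=
    N_k], and it remains to take the [N_k] among the integers at which this
    number is nearly [6 / pi ^ 2 * N_k].  There are arbitrarily large ones
    ([exists_squarefree_count]): every [n] is a square times a squarefree
    number, so [N] is at most the sum over [d] of the number of squarefree
    integers up to [N / d ^ 2]; a smaller upper density would contradict the
    bound [pi ^ 2 / 6] on the sum of the [1 / d ^ 2]. *)

(** * The bound 1 + 1/4 + 1/9 + ... <= pi^2/6 *)

Lemma sin_le_id (R : realType) (x : R) : 0 <= x -> sin x <= x.
Proof.
rewrite le_eqVlt => /orP[/eqP <-|x_gt0]; first by rewrite sin0.
have dx (y : R) : y \in `]0, x[ ->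
    is_derive y 1 (fun y => y - sin y) (1 - cos y).
  by move=> _; apply: is_deriveB.
have cx : {within `[0, x], continuous (fun y : R => y - sin y)}.
  apply: derivable_within_continuous => y _; exact: ex_derive.
have [c _] := MVT x_gt0 dx cx.
rewrite sin0 !subr0 => e; rewrite -subr_ge0 e.
by rewrite mulr_ge0 ?subr_ge0 ?cos_le1 // ltW.
Qed.

(** This is [sin^-2 + cos^-2 = (sin * cos)^-2], with the cosine written as the sine of
    the complementary angle so that the identity can be iterated. *)
Lemma csc2_half (R : realType) (y : R) : 0 < y < pi / 2 ->
  (sin y) ^- 2 + (sin (pi / 2 - y)) ^- 2 = 4 * (sin (y *+ 2)) ^- 2.
Proof.
move=> /andP[y_gt0 y_lt].
have s0 : sin y != 0 by rewrite gt_eqF // sin_gt0_pihalf // y_gt0.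
have c0 : cos y != 0.
  by rewrite gt_eqF // cos_gt0_pihalf // y_lt andbT; have := pi_gt0 R; lra.
have -> : sin (pi / 2 - y) = cos y by rewrite addrC sinDpihalf cosN.
rewrite sin_mulr2n -mulr_natl.
have := cos2Dsin2 y => e.
transitivity (((cos y) ^+ 2 + (sin y) ^+ 2) / (cos y * sin y) ^+ 2).
  by field; rewrite s0 c0.
by rewrite e; field; rewrite s0 c0.
Qed.

(** Halving an angle [x] of the first quadrant by [csc2_half] produces [x / 2] and
    [pi / 2 - x / 2]; starting from [pi / 4], this yields exactly the odd multiples
    of [pi / 2 ^ (n + 2)] in the quadrant, and the sum is multiplied by 4. *)
Lemma sum_csc2 (R : realType) (n : nat) :
  \sum_(0 <= k < 2 ^ n) (sin ((2 * k + 1)%:R * pi / 2 ^+ n.+2)) ^- 2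
  = 2 * 4 ^+ n :> R.
Proof.
elim: n => [|n IHn].
  rewrite expn0 big_nat1 expr0 mulr1.
  have p0 := pi_gt0 R.
  have := @csc2_half R (pi / 4); have -> : pi / 2 - pi / 4 = pi / 4 :> R by lra.
  have -> : pi / 4 *+ 2 = pi / 2 :> R by rewrite -mulr_natl; field.
  rewrite sin_pihalf expr1n invr1 mulr1.
  have -> : (2 * 0 + 1)%:R * pi / 2 ^+ 2 = pi / 4 :> R by field.
  have b : 0 < (pi / 4 : R) < pi / 2 by apply/andP; split; lra.
  by move=> /(_ b); lra.
have pow2 : (2 ^ n.+1 = 2 ^ n + 2 ^ n)%N by rewrite expnS mul2n addnn.
rewrite (big_cat_nat (n := 2 ^ n)%N) //=; last by rewrite pow2 leq_addl.
(* The upper half of the range, read backwards, consists of the complementary angles. *)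
rewrite [X in _ + X]big_nat_rev /= -{2}[(2 ^ n)%N]add0n big_addn pow2 addnK.
have -> : 2 * 4 ^+ n.+1 = 4 * (2 * 4 ^+ n) :> R by rewrite exprS mulrCA.
rewrite -big_split /= -IHn big_distrr /=.
apply: eq_big_nat => k /= k_lt.
set y := _ * pi / _.
have e2 : 2 ^+ n.+2 = 4 * (2 ^ n)%:R :> R by rewrite natrX !exprS; ring.
have e3 : 2 ^+ n.+3 = 8 * (2 ^ n)%:R :> R by rewrite natrX !exprS; ring.
have p0 : (2 ^ n)%:R != 0 :> R by rewrite pnatr_eq0 -lt0n expn_gt0.
have -> : (2 * k + 1)%:R * pi / 2 ^+ n.+2 = y *+ 2 :> R.
  by rewrite /y -mulr_natl e2 e3; field.
rewrite -csc2_half.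
  congr (_ + (sin _) ^- 2); rewrite /y e3.
  have -> : (2 * (2 ^ n + (2 ^ n + 2 ^ n) - (k + 2 ^ n).+1) + 1 =
             4 * 2 ^ n - (2 * k + 1))%N by lia.
  by rewrite natrB; [rewrite natrM; field | lia].
rewrite /y e3.
have P := pi_gt0 R.
have q0 : 0 < (2 ^ n)%:R :> R by rewrite ltr0n expn_gt0.
rewrite divr_gt0 ?mulr_gt0 ?ltr0n ?addn1 ?expn_gt0 //=.
rewrite ltr_pdivrMr ?mulr_gt0 //.
have -> : pi / 2 * (8 * (2 ^ n)%:R) = pi * (4 * (2 ^ n)%:R) :> R by field.
rewrite mulrC ltr_pM2l // -natrM ltr_nat; lia.
Qed.

(** Bound each term of [sum_csc2] below by [sin x <= x]. *)
Lemma sum_inv_odd_sqr (R : realType) (D : nat) :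
  \sum_(0 <= k < D) (2 * k + 1)%:R ^- 2 <= pi ^+ 2 / 8 :> R.
Proof.
have D_lt : (D <= 2 ^ D)%N by apply/ltnW/ltn_expl.
apply: (@le_trans _ _ (\sum_(0 <= k < 2 ^ D) (2 * k + 1)%:R ^- 2)).
  by rewrite [leRHS](big_cat_nat (n := D)) //= lerDl sumr_ge0 // => k _; rewrite ?invr_ge0 ?exprn_ge0.
set c : R := 2 ^+ D.+2 / pi.
have p0 := pi_gt0 R.
have c0 : 0 < c by rewrite divr_gt0 ?exprn_gt0.
have c2 : 0 < c ^+ 2 by rewrite exprn_gt0.
rewrite -(ler_pM2l c2) big_distrr /=.
have -> : c ^+ 2 * (pi ^+ 2 / 8) = 2 * 4 ^+ D.
  have -> : 4 ^+ D = (2 ^+ D) ^+ 2 :> R.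
    by rewrite -exprM mulnC exprM; congr (_ ^+ _); ring.
  have -> : c = 4 * 2 ^+ D / pi by rewrite /c !exprS; congr (_ / _); ring.
  by move: (pi : R) (lt0r_neq0 p0) => p p_neq0; field.
rewrite -(sum_csc2 R D) ler_sum_nat // => k /= k_lt.
have t_gt0 : 0 < 2 ^+ D.+2 :> R by rewrite exprn_gt0.
have k_gt0 : 0 < (2 * k + 1)%:R :> R by rewrite ltr0n addn1.
set x : R := _ * pi / _.
have x_gt0 : 0 < x by rewrite /x; exact: divr_gt0 (mulr_gt0 k_gt0 p0) t_gt0.
have sn : 0 < sin x.
  apply: sin_gt0_pi; rewrite x_gt0 /= ltr_pdivrMr // mulrC ltr_pM2l //.
  by rewrite -natrX ltr_nat !expnS; lia.
have -> : c ^+ 2 * (2 * k + 1)%:R ^- 2 = x ^- 2.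
  have k0 := lt0r_neq0 k_gt0; have t0 := lt0r_neq0 t_gt0.
  rewrite /x /c; move: (_%:R : R) k0 (2 ^+ _ : R) t0 (pi : R) (lt0r_neq0 p0).
  by move=> m m0 t t0 p p_neq0; field; rewrite m0 t0 p_neq0.
rewrite lef_pV2 ?posrE ?exprn_gt0 //.
by rewrite ler_pXn2r ?nnegrE ?(ltW sn) ?(ltW x_gt0) // sin_le_id // ltW.
Qed.

(** The even terms are a quarter of the whole sum, so the odd ones are three
    quarters of it. *)
Lemma sum_inv_sqr (R : realType) (D : nat) :
  \sum_(1 <= d < D.+1) d%:R ^- 2 <= pi ^+ 2 / 6 :> R.
Proof.
have split2 n : \sum_(1 <= d < n.*2.+1) d%:R ^- 2 =
    \sum_(0 <= k < n) (2 * k + 1)%:R ^- 2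
    + 4^-1 * \sum_(1 <= d < n.+1) d%:R ^- 2 :> R.
  elim: n => [|n IHn]; first by rewrite !big_geq // mulr0 addr0.
  rewrite doubleS big_nat_recr //= big_nat_recr //= IHn.
  rewrite [in RHS]big_nat_recr //= [in RHS](@big_nat_recr _ _ _ _ 1) //=.
  have -> : n.*2.+2%:R = 2 * n.+1%:R :> R by rewrite -natrM mul2n doubleS.
  rewrite mul2n addn1; have n0 : n.+1%:R != 0 :> R by rewrite pnatr_eq0.
  have m0 : n.*2.+1%:R != 0 :> R by rewrite pnatr_eq0.
  by move: (n.+1%:R : R) n0 (n.*2.+1%:R : R) m0 => x x0 y y0; field; rewrite x0 y0.
have h := sum_inv_odd_sqr R D.
have := split2 D.
have : \sum_(1 <= d < D.+1) d%:R ^- 2 <= \sum_(1 <= d < D.*2.+1) d%:R ^- 2 :> R.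
  rewrite [leRHS](big_cat_nat (n := D.+1)) //=; last by rewrite ltnS; lia.
  by rewrite lerDl sumr_ge0 // => k _; rewrite ?invr_ge0 ?exprn_ge0.
lra.
Qed.

(** * Density of the squarefree numbers *)

Definition squarefree (n : nat) : bool := moebius n != 0.

Lemma moebius_unit (n : nat) : moebius n = 0 \/ moebius n = 1 \/ moebius n = -1.
Proof.
rewrite /moebius; case: ifP => _; last by left.
by rewrite -signr_odd; case: odd; rewrite ?expr0 ?expr1; right; [right|left].
Qed.

Lemma moebius_sqr (n : nat) : moebius n * moebius n = (squarefree n)%:R.
Proof.
rewrite /squarefree; have [->|[->|->]] := moebius_unit n;
  by rewrite ?mulr0 ?eqxx ?mulr1 ?mulrNN ?oppr_eq0 ?oner_eq0.
Qed.

(** A number all of whose prime exponents are at most 1 is the product of its primes. *)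
Lemma square_divisor (n : nat) : (0 < n)%N -> ~~ squarefree n ->
  exists2 p, (1 < p)%N & (p ^ 2 %| n)%N.
Proof.
move=> n_gt0; rewrite /squarefree /moebius.
case: ifP => [_|/negP n_neq _]; first by rewrite negbK expf_eq0 oppr_eq0 oner_eq0 andbF.
have [/allP h|] := boolP (all (fun p => logn p n <= 1)%N (primes n)).
  case: n_neq; apply/eqP; rewrite {1}[n]prod_prime_decomp //.
  rewrite prime_decompE big_map /=.
  apply: eq_big_seq => p p_n /=.
  have := h p p_n; move: (p_n); rewrite -logn_gt0.
  by case: logn => [|[]].
case/allPn => p p_n; rewrite -ltnNge => l; exists p.
  by move: p_n; rewrite mem_primes => /andP[/prime_gt1].
rewrite pfactor_dvdn //; by move: p_n; rewrite mem_primes => /andP[].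
Qed.

Lemma squarefree_decomposition (n : nat) : (0 < n)%N ->
  exists d q, [/\ (0 < d)%N, squarefree q & n = (d ^ 2 * q)%N].
Proof.
elim/ltn_ind: n => n IHn n_gt0.
have [sf|/(square_divisor n_gt0)[p p_gt1 /dvdnP[m e]]] := boolP (squarefree n).
  by exists 1%N, n; rewrite mul1n.
have m_gt0 : (0 < m)%N by move: n_gt0; rewrite e; case: (m).
have m_lt : (m < n)%N by rewrite e -mulnn; nia.
have [d [q [d_gt0 sfq em]]] := IHn m m_lt m_gt0.
exists (d * p)%N, q; split=> //; first by rewrite muln_gt0 d_gt0 ltnW.
by rewrite e em expnMn; ring.
Qed.

Definition squarefree_count (N : nat) : nat :=
  \sum_(1 <= n < N.+1) squarefree n.

Lemma sum_multiples (d N : nat) (f : nat -> nat) : (0 < d)%N ->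
  (\sum_(1 <= n < N.+1) (d %| n) * f (n %/ d) =
   \sum_(1 <= m < (N %/ d).+1) f m)%N.
Proof.
move=> d_gt0; elim: N => [|N IHN]; first by rewrite div0n !big_nil.
rewrite big_nat_recr //= IHN divnS //.
case: (d %| N.+1)%N; last by rewrite mul0n addn0.
by rewrite mul1n [in RHS]big_nat_recr //= add1n.
Qed.

(** Each [n <= T ^ 2] is counted on the right through some [d] for which [n / d ^ 2] is
    squarefree. *)
Lemma squarefree_count_sum (T : nat) :
  (T ^ 2 <= \sum_(1 <= d < T.+1) squarefree_count (T ^ 2 %/ d ^ 2))%N.
Proof.
set N := (T ^ 2)%N.
rewrite (@leq_trans (\sum_(1 <= n < N.+1) \sum_(1 <= d < T.+1)
   (d ^ 2 %| n) * squarefree (n %/ d ^ 2))%N) //.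
  rewrite -[leqLHS](subn1 N.+1) -{1}[(N.+1 - 1)%N]muln1 -sum_nat_const_nat.
  rewrite big_nat [leqRHS]big_nat; apply: leq_sum => n /andP[n_gt0].
  rewrite ltnS => n_le; have [d [q [d_gt0 sfq e]]] := squarefree_decomposition n_gt0.
  have q_gt0 : (0 < q)%N by move: n_gt0; rewrite e; case: (q); rewrite ?muln0.
  have d_le : (d < T.+1)%N.
    by rewrite ltnS -(@leq_exp2r _ _ 2) // (leq_trans _ n_le) // e leq_pmulr.
  rewrite (bigD1_seq d) /= ?iota_uniq //; last by rewrite mem_index_iota d_gt0.
  by rewrite e dvdn_mulr // mulKn ?expn_gt0 ?d_gt0 // sfq.
rewrite exchange_big /= big_nat [leqRHS]big_nat.
apply: leq_sum => d /andP[d_gt0 _].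
by rewrite (@sum_multiples (d ^ 2) N (fun m => squarefree m : nat)) // expn_gt0 d_gt0.
Qed.

(** If the count stayed below [c N] for [N >= M], then [squarefree_count_sum] would
    give [T ^ 2 <= c T ^ 2 (pi ^ 2 / 6) + M T] for every [T], although
    [c pi ^ 2 / 6 < 1]. *)
Lemma exists_squarefree_count (R : realType) (c : R) (M : nat) :
  c < 6 / pi ^+ 2 ->
  exists2 N, (M <= N)%N & c * N%:R <= (squarefree_count N)%:R.
Proof.
move=> c_lt; have [c_le0|c_gt0] := lerP c 0.
  by exists M => //; rewrite (le_trans _ (ler0n _ _)) // mulr_le0_ge0.
apply: contrapT => no.
(* The summand [M] absorbs the range below [M], where only the trivial bound is known. *)
have Q_le N : (squarefree_count N)%:R <= c * N%:R + M%:R.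
  have [N_lt|M_le] := ltnP N M.
    rewrite (@le_trans _ _ (N%:R)) //.
      rewrite ler_nat -[leqRHS](subn1 N.+1) -[(N.+1 - 1)%N]muln1.
      rewrite -sum_nat_const_nat; apply: leq_sum => n _; exact: leq_b1.
    by rewrite (@le_trans _ _ M%:R) ?ler_nat ?(ltnW N_lt) // lerDr mulr_ge0 // ltW.
  rewrite (@le_trans _ _ (c * N%:R)) ?lerDl //.
  by rewrite leNgt; apply/negP => /ltW h; apply: no; exists N.
have p0 := pi_gt0 R.
have p2 : 0 < pi ^+ 2 :> R by rewrite exprn_gt0.
set a := 1 - c * (pi ^+ 2 / 6).
have a_gt0 : 0 < a.
  rewrite subr_gt0 mulrA ltr_pdivrMr // mul1r.
  by move: c_lt; rewrite ltr_pdivlMr.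
have T_le (T : nat) : a * T%:R ^+ 2 <= M%:R * T%:R.
  have : (T ^ 2)%:R <= \sum_(1 <= d < T.+1) (c * T%:R ^+ 2 * d%:R ^- 2 + M%:R) :> R.
    have := squarefree_count_sum T; rewrite -(ler_nat R) natr_sum => h.
    apply: le_trans h _; apply: ler_sum_nat => d /andP[d_gt0 _].
    apply: le_trans (Q_le _) _; rewrite lerD2r -mulrA ler_pM2l //.
    have d2 : 0 < d%:R ^+ 2 :> R by rewrite exprn_gt0 // ltr0n.
    by rewrite ler_pdivlMr // -!natrX -natrM ler_nat leq_trunc_div.
  rewrite big_split /= -big_distrr /= sumr_const_nat subn1 /= natrX.
  have := ler_wpM2l (mulr_ge0 (ltW c_gt0) (sqr_ge0 T%:R)) (sum_inv_sqr R T).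
  rewrite -[M%:R *+ _]mulr_natr /a => h1 h2.
  rewrite mulrBl mul1r lerBlDl (le_trans h2) // lerD2r (le_trans h1) //.
  by rewrite mulrAC.
have [T hT] : exists T : nat, M%:R / a < T%:R.
  by exists (Num.truncn (M%:R / a)).+1; apply: truncnS_gt.
have T0 : 0 < T%:R :> R by rewrite (le_lt_trans _ hT) // divr_ge0 // ltW.
have := T_le T; rewrite expr2 mulrA ler_pM2r // leNgt => /negP; apply.
by move: hT; rewrite ltr_pdivrMr // mulrC.
Qed.

(** * Squares modulo a prime *)

(** If [n] and [n0] have the same square modulo [p], then [p] divides
    [(n + n0) (n - n0)]; hence [n] is [n0] or its opposite. *)
Lemma card_sqrt_mod (p c W : nat) : prime p ->
  (#|[set n : 'I_p | ((n ^ 2 + W) %% p == c)%N]%SET| <= 2)%N.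
Proof.
move=> p_pr; have p_gt0 := prime_gt0 p_pr.
have [->|[n0]] := set_0Vmem [set n : 'I_p | ((n ^ 2 + W) %% p == c)%N]%SET.
  by rewrite cards0.
rewrite inE => /eqP n0_c.
pose opp : 'I_p := Ordinal (ltn_pmod (p - n0) p_gt0).
apply: (@leq_trans #|[set n0; opp]%SET|); last by rewrite cards2; case: eqP.
apply/subset_leq_card/fintype.subsetP => n; rewrite !inE -n0_c eqn_modDr.
move=> sq; suff : (p %| n + (p - n0))%N || (p %| n + n0)%N.
  have n_lt := ltn_ord n; have n0_lt := ltn_ord n0.
  case/orP => /dvdnP[q e]; apply/orP.
    left; apply/eqP/val_inj => /=; move: e.
    by case: q => [|[|q]]; rewrite ?mulSn ?mul0n; lia.
  right; apply/eqP/val_inj => /=; have [n0_0|n0_gt0] := posnP n0.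
    move: e; rewrite n0_0 subn0 modnn addn0.
    by case: q => [|q]; rewrite ?mulSn ?mul0n; lia.
  rewrite modn_small; last by lia.
  by move: e; case: q => [|[|q]]; rewrite ?mulSn ?mul0n; lia.
rewrite orbC -Euclid_dvdM //.
have n0_lt := ltnW (ltn_ord n0).
have -> : ((n + n0) * (n + (p - n0)) = n ^ 2 + p * (n + n0) - n0 ^ 2)%N.
  move: (nat_of_ord n) (nat_of_ord n0) n0_lt => x y /subnKC <-.
  by move: (p - y)%N => z; rewrite -!mulnn addKn; nia.
rewrite -eqn_mod_dvd; first by rewrite addnC mulnC modnMDl.
by rewrite -!mulnn; nia.
Qed.

(** The condition says that [n ^ 2] is within [W] of a multiple of [p]: it allows
    [2 W + 1] residues, with at most two square roots each. *)
Lemma sum_near_period (p W : nat) : prime p ->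
  (\sum_(0 <= n < p) ((n ^ 2 + W) %% p <= 2 * W) <= 2 * (2 * W + 1))%N.
Proof.
move=> p_pr.
apply: (@leq_trans (\sum_(0 <= c < 2 * W + 1)
   \sum_(0 <= n < p) ((n ^ 2 + W) %% p == c))%N).
  rewrite exchange_big /=; apply: leq_sum => n _.
  have [h|//] := leqP ((n ^ 2 + W) %% p)%N (2 * W).
  rewrite (bigD1_seq ((n ^ 2 + W) %% p)%N) /= ?iota_uniq ?eqxx //.
  by rewrite mem_index_iota addn1 ltnS h.
apply: (@leq_trans (\sum_(0 <= c < 2 * W + 1) 2)%N).
  apply: leq_sum => c _; rewrite big_mkord.
  apply: leq_trans (card_sqrt_mod c W p_pr); rewrite -sum1_card [leqRHS]big_mkcond /=.
  by apply: leq_sum => n _; rewrite inE; case: eqP.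
by rewrite sum_nat_const_nat subn0 mulnC.
Qed.

Lemma sum_periodic (p q : nat) (f : nat -> nat) : (forall n, f (n + p) = f n)%N ->
  (\sum_(0 <= n < q * p) f n = q * \sum_(0 <= n < p) f n)%N.
Proof.
move=> f_p; elim: q => [|q IHq]; first by rewrite !mul0n big_geq.
rewrite mulSn [LHS](big_cat_nat (n := p)) //= ?leq_addr // mulSn; congr addn.
rewrite -{1}[p]add0n big_addn addKn -IHq.
by apply: eq_bigr => n _.
Qed.

Lemma count_near (p W N : nat) : prime p ->
  (\sum_(1 <= n < N.+1) ((n ^ 2 + W) %% p <= 2 * W)
   <= (N %/ p).+1 * (2 * (2 * W + 1)))%N.
Proof.
move=> p_pr; have p_gt0 := prime_gt0 p_pr.
pose f n : nat := ((n ^ 2 + W) %% p <= 2 * W)%N.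
have N_lt : (N.+1 <= (N %/ p).+1 * p)%N by exact: ltn_ceil.
apply: (@leq_trans (\sum_(0 <= n < (N %/ p).+1 * p) f n)).
  rewrite [leqRHS](big_cat_nat (n := 1)) //=; last exact: leq_trans N_lt.
  by rewrite [X in (_ <= _ + X)%N](big_cat_nat (n := N.+1)) //= addnCA leq_addr.
rewrite sum_periodic; first by rewrite leq_pmul2l // sum_near_period.
move=> n; rewrite /f sqrnD; congr (nat_of_bool (_ <= _)%N).
by have -> : (n ^ 2 + p ^ 2 + 2 * (n * p) + W = (p + 2 * n) * p + (n ^ 2 + W))%N;
  [nia | rewrite modnMDl].
Qed.

(** * Cylinders and Toeplitz sequences *)

Section Cylinders.
Variable A : finType.
Implicit Types (x y : biseq A) (s : seq int).

Definition cylinder x s : set (biseq A) := [set y | forall i, i \in s -> y i = x i].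

Lemma nbhs_cylinder x s : nbhs x (cylinder x s).
Proof.
have x_filter := @nbhs_filter {ptws int -> discrete_topology A} x.
elim: s => [|i s IHs]; first by by apply: filterS filterT => y _ j.
have xi : nbhs x [set y | y i = x i].
  exact: (@proj_continuous _ (fun _ : int => discrete_topology A) i x
           [set x i] (discrete_set1 (x i : discrete_topology A))).
apply: filterS (filterI xi IHs) => y [/= yi ys] j.
by rewrite inE => /orP[/eqP ->|/ys].
Qed.

(** The supersets of cylinders form a filter; it converges to [x] because it does so
    in each coordinate. *)
Lemma cylinder_basis x (U : set (biseq A)) :
  nbhs x U -> exists s, cylinder x s `<=` U.
Proof.
pose F : set_system (biseq A) := [set V | exists s, cylinder x s `<=` V].
have F_filter : Filter F.
  split; first by exists [::].
    move=> V W [s sV] [t tW]; exists (s ++ t) => y y_st; split.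
      by apply: sV => i i_s; apply: y_st; rewrite mem_cat i_s.
    by apply: tW => i i_t; apply: y_st; rewrite mem_cat i_t orbT.
  by move=> V W VW [s sV]; exists s; apply: subset_trans VW.
move=> xU; suff cv : F --> (x : {ptws int -> discrete_topology A}) by apply: (cv U xU).
apply/cvg_sup => i.
apply/cvg_image => [|B /nbhs_singleton Bxi].
  by rewrite eqEsubset; split => // a _; exists (fun=> a).
exists [set y | B (y i)].
  by exists [:: i] => y /= -> //; rewrite inE.
by rewrite eqEsubset; split => [_ [y /= By <-]|a Ba] //; exists (fun=> a).
Qed.

Lemma iterz_bishiftE (n : int) x i : iterz (@bishift A) (@bishift_inv A) n x i = x (i + n).
Proof.
case: n => k /=.
  elim: k i => [|k IHk] i; first by rewrite addr0.
  by rewrite iterS /bishift IHk -addrA -PoszD add1n.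
rewrite -[RHS]/(x (i + Negz k)); elim: k i => [|k IHk] i //.
by rewrite iterS {1}/bishift_inv IHk; congr x; rewrite !NegzE; lia.
Qed.

(** A neighbourhood only constrains finitely many coordinates. *)
Lemma toeplitz_periodic x :
  (forall s, exists2 l, (0 < l)%N &
     forall (t : int) i, i \in s -> x (i + l%:Z * t) = x i) ->
  toeplitz x.
Proof.
move=> x_per U U_open Ux.
have [s sU] := cylinder_basis (open_nbhs_nbhs (conj U_open Ux)).
have [l l_gt0 l_per] := x_per s; exists l => // _ [t _ <-] /=.
by apply: sU => i i_s; rewrite iterz_bishiftE l_per.
Qed.

End Cylinders.

(** * Entropy of an orbit closure *)

Lemma ln_nat_ge0 (R : realType) (n : nat) : 0 <= ln n%:R :> R.
Proof. by case: n => [|n]; [rewrite ln0 | rewrite ln_ge0 // ler1n]. Qed.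

Lemma ler_ln_nat (R : realType) (m n : nat) : (m <= n)%N -> ln m%:R <= ln n%:R :> R.
Proof.
case: m => [|m] mn; first by rewrite [leLHS]ln0 // ln_nat_ge0.
by rewrite ler_ln ?posrE ?ltr0n ?ler_nat // (leq_trans _ mn).
Qed.

Lemma ln_nat_le (R : realType) (n : nat) : ln n%:R <= n%:R :> R.
Proof.
case: n => [|n]; first by rewrite ln0.
rewrite -[n.+1%:R in leLHS]nat1r (le_trans (le_ln1Dx _)) //.
  by rewrite (lt_le_trans _ (ler0n _ _)) // ltrN10.
by rewrite ler_nat.
Qed.

(** With [u] the integer fourth root of [L] and [t = u + 1], the logarithm is
    [O(t ^ 2 ln t)]; the crude bound [ln t <= t] makes it [O(u ^ 3) = O(L / u)]. *)
Lemma ln_sparse_le (R : realType) (a L u : nat) :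
  (0 < u)%N -> (u ^ 4 <= L < u.+1 ^ 4)%N ->
  u%:R * ln (L * (L * a).+1 ^ (u.+1 ^ 2))%:R <= (8 * (9 + a))%:R * L%:R :> R.
Proof.
move=> u_gt0 /andP[u_L L_u].
have L_gt0 : (0 < L)%N by apply: leq_trans u_L; rewrite expn_gt0 u_gt0.
have t_gt0 : 0 < u.+1%:R :> R by rewrite ltr0n.
have lnL : ln L%:R <= (4 * u.+1)%:R :> R.
  apply: le_trans (ler_ln_nat R (ltnW L_u)) _; rewrite natrX lnXn //.
  by rewrite mulnC natrM mulr_natr ler_wMn2r // ln_nat_le.
have lnLa : ln (L * a).+1%:R <= (4 * u.+1 + a.+1)%:R :> R.
  apply: (@le_trans _ _ (ln (u.+1 ^ 4 * a.+1)%:R)); first by apply: ler_ln_nat; nia.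
  rewrite natrM lnM ?posrE ?ltr0n ?expn_gt0 // natrD lerD ?ln_nat_le //.
  by rewrite natrX lnXn // mulnC natrM mulr_natr ler_wMn2r // ln_nat_le.
rewrite natrM lnM ?posrE ?ltr0n ?expn_gt0 // natrX lnXn ?ltr0n //.
apply: (@le_trans _ _ (u * (4 * u.+1 + u.+1 ^ 2 * (4 * u.+1 + a.+1)))%:R); last first.
  rewrite -natrM ler_nat.
  have h : (u.+1 <= 2 * u)%N by lia.
  have h2 : (u.+1 ^ 2 <= 4 * u ^ 2)%N by have := leq_mul h h; rewrite -!mulnn; lia.
  have h3 : (4 * u.+1 + a.+1 <= (9 + a) * u)%N by nia.
  have h4 := leq_mul h2 h3.
  have h5 : (4 * u.+1 <= 8 * u ^ 3)%N by rewrite !expnS; nia.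
  apply: (@leq_trans (u * (8 * u ^ 3 + 4 * u ^ 2 * ((9 + a) * u)))).
    by rewrite leq_mul2l leq_add ?orbT.
  apply: (@leq_trans (8 * (9 + a) * u ^ 4)); last by rewrite leq_mul2l u_L orbT.
  have -> : (u * (8 * u ^ 3 + 4 * u ^ 2 * ((9 + a) * u)) =
             (8 + 4 * (9 + a)) * u ^ 4)%N by rewrite !expnS; ring.
  by rewrite leq_mul2r; apply/orP; right; lia.
rewrite natrM ler_wpM2l ?ler0n // natrD lerD // natrM -[ln _ *+ _]mulr_natr mulrC.
by rewrite ler_wpM2l ?ler0n.
Qed.

Section Entropy.
Variables (A : finType) (x : biseq A).

Definition words n : {set n.-tuple A} := [set w | `[< occurs_in w x >]]%SET.

Lemma window_words n (i : int) :
  [tuple x (i + (k : nat)%:Z) | k < n] \in words n.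
Proof. by rewrite finset.in_set; apply/asboolP; exists i => k; rewrite tnth_mktuple. Qed.

Lemma words_gt0 n : (0 < #|words n|)%N.
Proof. by apply/card_gt0P; exists [tuple x (0 + (k : nat)%:Z) | k < n]; apply: window_words. Qed.

(** A word of a limit point already occurs in the orbit, since fixing its letters
    defines a neighbourhood. *)
Lemma complexity_orbit_closure n :
  (complexity (orbit_closure x) n <= #|words n|)%N.
Proof.
apply/subset_leq_card/fintype.subsetP => w.
rewrite finset.in_set => /asboolP[y x_y [i w_y]]; rewrite finset.in_set; apply/asboolP.
have [_ [[m _ <-] z_y]] :=
  x_y _ (nbhs_cylinder y [seq i + k%:Z | k <- iota 0 n]).
exists (i + m) => k; rewrite w_y -z_y ?iterz_bishiftE; last first.
  by apply/mapP; exists (k : nat); rewrite // mem_iota ltn_ord.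
by rewrite addrAC.
Qed.

Lemma card_words_add m n : (#|words (m + n)| <= #|words m| * #|words n|)%N.
Proof.
pose cut (w : (m + n).-tuple A) : m.-tuple A * n.-tuple A :=
  ([tuple tnth w (lshift n k) | k < m], [tuple tnth w (rshift m k) | k < n]).
have cut_inj : injective cut.
  move=> v w e; apply: eq_from_tnth => k.
  rewrite -(splitK k); case: (fintype.split k) => j.
    by have := congr1 (fun t => tnth t.1 j) e; rewrite !tnth_mktuple.
  by have := congr1 (fun t => tnth t.2 j) e; rewrite !tnth_mktuple.
rewrite -cardsX -(card_imset _ cut_inj); apply/subset_leq_card/fintype.subsetP.
move=> _ /imsetP[w + ->]; rewrite finset.in_set => /asboolP[i w_i].
rewrite finset.in_setX !finset.in_set; apply/andP; split; apply/asboolP.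
  by exists i => k; rewrite tnth_mktuple w_i.
by exists (i + m%:Z) => k; rewrite tnth_mktuple w_i /= -addrA.
Qed.

Lemma card_words_mul q L r : (#|words (q * L + r)| <= #|words L| ^ q * #|A| ^ r)%N.
Proof.
elim: q => [|q IHq].
  by rewrite mul0n add0n expn0 mul1n -card_tuple max_card.
rewrite mulSn -addnA expnS -mulnA.
by apply: leq_trans (card_words_add _ _) _; rewrite leq_mul2l IHq orbT.
Qed.

Variable R : realType.

(** Submultiplicativity of the number of words propagates a good bound at one length
    [L] to all large lengths, so the limit exists and is zero as soon as the growth
    rate is small along some lengths. *)
Lemma has_entropy0 :
  (forall d : R, 0 < d ->
     exists2 L, (0 < L)%N & ln #|words L|%:R <= d * L%:R) ->
  has_entropy (orbit_closure x) (0 : R).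
Proof.
move=> small; apply/cvgrPdist_le => e e_gt0.
have [|L L_gt0 L_small] := small (e / 2); first by rewrite divr_gt0.
have A_gt0 : (0 < #|A|)%N by apply/card_gt0P; exists (x 0).
near=> n.
have n_gt0 : 0 < n%:R :> R by rewrite ltr0n; near: n; exact: nbhs_infty_gt.
rewrite sub0r normrN ger0_norm ?divr_ge0 ?ln_nat_ge0 // ler_pdivrMr //.
apply: le_trans (ler_ln_nat R (complexity_orbit_closure n)) _.
have := card_words_mul (n %/ L) L (n %% L); rewrite -divn_eq => n_words.
apply: le_trans (ler_ln_nat R n_words) _.
rewrite natrM !natrX lnM ?posrE ?exprn_gt0 ?ltr0n ?words_gt0 //.
rewrite !lnXn ?ltr0n ?words_gt0 //.
rewrite -[_ *+ (n %/ L)]mulr_natr -[_ *+ (n %% L)]mulr_natr.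
have h1 : ln #|words L|%:R * (n %/ L)%:R <= e / 2 * n%:R.
  apply: le_trans (ler_wpM2r (ler0n _ _) L_small) _.
  rewrite -[leLHS]mulrA ler_wpM2l ?divr_ge0 ?(ltW e_gt0) // -natrM ler_nat mulnC.
  exact: leq_trunc_div.
have h2 : ln #|A|%:R * (n %% L)%:R <= (#|A| * L)%:R :> R.
  rewrite natrM ler_pM ?ln_nat_ge0 ?ln_nat_le ?ler0n // ler_nat.
  by rewrite ltnW // ltn_mod.
have h3 : (#|A| * L)%:R <= e / 2 * n%:R.
  rewrite mulrC -ler_pdivrMr ?divr_gt0 //; near: n; exact: nbhs_infty_ger.
lra.
Unshelve. all: by end_near.
Qed.

End Entropy.

(** * Sequences assembled from blocks *)

(** Stated with weights [2 ^ (j + 1)] so that the losses of all stages, controlled one by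
    one, add up to at most [M]. *)
Lemma sum_geometric_le (k M : nat) (x : nat -> nat) :
  (forall j, 2 ^ j.+1 * x j <= M)%N -> (\sum_(0 <= j < k) x j <= M)%N.
Proof.
move=> x_le; suff : (2 ^ k * \sum_(0 <= j < k) x j <= (2 ^ k - 1) * M)%N.
  by have := expn_gt0 2 k; nia.
elim: k => [|k IHk]; first by rewrite big_geq.
rewrite big_nat_recr //= mulnDr expnS.
have := x_le k; have := expn_gt0 2 k; rewrite expnS; nia.
Qed.

Section BlockSequence.
Variables (A : finType) (g : int -> A) (a0 : A) (N P : nat -> nat).

(** The block around a multiple of [P k] extends by [N k] beyond its last square
    [N k ^ 2], which keeps the ends of blocks free of nonzero letters
    at the scale [N k]. *)
Definition reach k : nat := N k ^ 2 + N k.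

(** The representative [r] of [m] modulo [P k] with [- reach k <= r < P k - reach k], so that
    [near_multiple] can be tested by an upper bound only. *)
Definition residue k (m : int) : int :=
  ((m + (reach k)%:Z) %% (P k)%:Z)%Z - (reach k)%:Z.

Definition near_multiple k (m : int) : bool := residue k m <= (reach k)%:Z.

(** The search is bounded because [m] lies in the block of index [|m|] around 0. *)
Definition level (m : int) : nat :=
  find (near_multiple^~ m) (iota 0 `|m|.+1).
Definition block_seq : biseq A := fun m => g (residue (level m) m).

Definition period k : nat := \prod_(j < k) P j.

Hypothesis N_gt0 : forall k, (0 < N k)%N.
Hypothesis period_le : forall k, (period k <= N k)%N.
Hypothesis P_gt : forall k, (2 * reach k < P k)%N.
Hypothesis g_support : forall m, g m != a0 -> exists n : nat, m = (n ^ 2)%N%:Z.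

Let P_gt0 k : (0 < P k)%N. Proof. exact: leq_ltn_trans (P_gt k). Qed.

Lemma period_gt0 k : (0 < period k)%N.
Proof. by rewrite /period; elim/big_rec: _ => // j n _ n_gt0; rewrite muln_gt0 P_gt0. Qed.

Lemma dvd_period j k : (j < k)%N -> (P j %| period k)%N.
Proof. by move=> jk; rewrite /period (bigD1 (Ordinal jk)) //= dvdn_mulr. Qed.

Lemma N_ltS k : (N k < N k.+1)%N.
Proof.
apply: leq_trans (period_le k.+1); rewrite /period big_ord_recr /= -/(period k).
apply: leq_trans (leq_pmull _ (period_gt0 k)); apply: leq_ltn_trans (P_gt k).
by rewrite /reach; lia.
Qed.

Lemma N_homo : {homo N : j k / (j <= k)%N}.
Proof. by apply: homo_leq => // [k j i|k]; [exact: leq_trans | exact: ltnW (N_ltS k)]. Qed.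

Lemma ltn_N k : (k < N k)%N.
Proof. by elim: k => [|k IHk]; [exact: N_gt0 | exact: leq_ltn_trans IHk (N_ltS k)]. Qed.

Lemma residue_add k m d : - (reach k)%:Z <= residue k m + d <= (reach k)%:Z ->
  residue k (m + d) = residue k m + d.
Proof.
rewrite /residue; set W := (reach k)%:Z; set p := (P k)%:Z => /andP[lo hi].
have W_p : 2 * W < p by have := P_gt k; rewrite /W /p; lia.
have e := divz_eq (m + W) p.
have -> : m + d + W = ((m + W) %/ p)%Z * p + (((m + W) %% p)%Z + d).
  by rewrite addrA -e addrAC.
rewrite modzMDl modz_small; first by rewrite addrAC.
by move: lo hi; move: (_ %% _)%Z => r; lia.
Qed.

Lemma residue_id k m : `|m| <= (reach k)%:Z -> residue k m = m.
Proof.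
move=> m_le; have zero : residue k 0 = 0.
  rewrite /residue add0r modz_small ?subrr //; have := P_gt k; lia.
by rewrite -[m in LHS]add0r residue_add zero add0r // -ler_norml.
Qed.

Lemma near_multiple_small k m : `|m| <= (reach k)%:Z -> near_multiple k m.
Proof. by move=> m_le; rewrite /near_multiple residue_id // (le_trans (ler_norm m)). Qed.

Lemma residue_shift k m t : (P k %| `|t|)%N -> residue k (m + t) = residue k m.
Proof.
move=> P_t; rewrite /residue; set W := (reach k)%:Z.
have /dvdzP[q ->] : (P k %| t)%Z by [].
have -> : m + q * (P k)%:Z + W = q * (P k)%:Z + (m + W) by ring.
by rewrite modzMDl.
Qed.

Lemma near_multiple_absz m : near_multiple `|m|%N m.
Proof.
apply: near_multiple_small; rewrite -abszE lez_nat.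
by rewrite /reach; have := ltn_N `|m|%N; lia.
Qed.

Lemma near_level m : near_multiple (level m) m.
Proof.
have h : has (near_multiple^~ m) (iota 0 `|m|.+1).
  by apply/hasP; exists `|m|%N; rewrite ?mem_iota //= near_multiple_absz.
have := nth_find 0%N h; rewrite nth_iota //.
by rewrite -[X in (_ < X)%N](size_iota 0) -has_find.
Qed.

Lemma level_le k m : near_multiple k m -> (level m <= k)%N.
Proof.
move=> km; rewrite leqNgt; apply/negP => k_lt.
have := before_find 0%N k_lt; rewrite nth_iota ?add0n ?km //.
by rewrite (leq_trans k_lt) // -[leqRHS](size_iota 0) find_size.
Qed.

(** Nearness to multiples of [P j] for [j < k] is unchanged by a translation by
    [period k], and the level of [m] is the first [j] for which [m] is near one. *)
Lemma level_shift k m t : (period k %| `|t|)%N -> (level m < k)%N ->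
  level (m + t) = level m.
Proof.
move=> per_t m_k.
have shift j : (j < k)%N -> near_multiple j (m + t) = near_multiple j m.
  move=> jk; rewrite /near_multiple residue_shift //.
  exact: dvdn_trans (dvd_period jk) per_t.
have le1 : (level (m + t)%R <= level m)%N by rewrite level_le // shift // near_level.
apply/eqP; rewrite eqn_leq le1 level_le // -shift ?near_level //.
exact: leq_ltn_trans le1 m_k.
Qed.

Lemma block_seq_shift k m t : (period k %| `|t|)%N -> (level m < k)%N ->
  block_seq (m + t) = block_seq m.
Proof.
move=> per_t m_k; rewrite /block_seq (level_shift per_t m_k) residue_shift //.
exact: dvdn_trans (dvd_period m_k) per_t.
Qed.

Lemma toeplitz_block_seq : toeplitz block_seq.
Proof.
apply: toeplitz_periodic => s.
exists (period (\max_(i <- s) level i).+1); first exact: period_gt0.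
move=> t i i_s; apply: (@block_seq_shift (\max_(i <- s) level i).+1).
  by rewrite abszM dvdn_mulr.
by rewrite ltnS (big_rem i) //= leq_maxl.
Qed.

(** The last square of the block is at distance [N (level m) >= N k] from its right end, and
    the squares are nonnegative, so the block contains the whole window around [m]. *)
Lemma block_window k m d : (k <= level m)%N -> block_seq m != a0 ->
  `|d| <= (N k)%:Z ->
  (level (m + d) <= level m)%N /\
  residue (level m) (m + d) = residue (level m) m + d.
Proof.
move=> k_m b_m d_le; have [n rE] := g_support b_m.
have := near_level m; rewrite /near_multiple rE lez_nat => n_le.
have n_leN : (n <= N (level m))%N.
  rewrite leqNgt; apply/negP => n_gt; have := leq_mul n_gt n_gt.
  by move: n_le; rewrite /reach -!mulnn; lia.
have e : residue (level m) (m + d) = residue (level m) m + d.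
  apply: residue_add; rewrite rE; have := leq_mul n_leN n_leN.
  by have := N_homo k_m; move: d_le; rewrite /reach -!mulnn; lia.
split; last by rewrite e rE.
apply: level_le; rewrite /near_multiple e rE.
have := leq_mul n_leN n_leN.
by have := N_homo k_m; move: d_le; rewrite /reach -!mulnn; lia.
Qed.

(** By [block_window] in both directions each position lies in the block of the
    other; as the smaller index wins, the two blocks coincide. *)
Lemma same_block k m d : (k <= level m)%N -> block_seq m != a0 ->
  (k <= level (m + d)%R)%N -> block_seq (m + d) != a0 -> `|d| <= (N k)%:Z ->
  residue (level (m + d)) (m + d) = residue (level m) m + d.
Proof.
move=> k_m b_m k_md b_md d_le.
have [le1 e] := block_window k_m b_m d_le.
have [|le2 _] := block_window k_md b_md (d := - d); first by rewrite normrN.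
rewrite addrK in le2.
by have -> : level (m + d) = level m by apply/eqP; rewrite eqn_leq le1.
Qed.

(** By [same_block] the positions concerned are, up to a translation, squares of
    an interval shorter than [s ^ 2].  If [n0 ^ 2] is the first one and [n ^ 2] another,
    then [(n - n0) ^ 2 <= n ^ 2 - n0 ^ 2 < s ^ 2], so [n - n0] can serve as label. *)
Lemma window_cover k (i : int) (s : nat) : (N k <= s ^ 2)%N ->
  exists h : 'I_s -> option 'I_(N k), forall t : 'I_(N k),
    (k <= level (i + (t : nat)%:Z)%R)%N -> block_seq (i + (t : nat)%:Z) != a0 ->
    exists x, h x = Some t.
Proof.
move=> N_s.
pose T t := (k <= level (i + t%:Z)%R)%N && (block_seq (i + t%:Z) != a0).
have [[t0 [Tt0 t0_min]]|noT] := pselect (exists t0 : nat,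
    T t0 /\ forall t, T t -> (t0 <= t)%N); last first.
  exists (fun=> None) => t k_t b_t; case: noT.
  have ex : exists t, T t by exists t; rewrite /T k_t.
  by exists (ex_minn ex); case: ex_minnP.
have [k0 b0] := andP Tt0; have [n0 r0] := g_support b0.
exists (fun x : 'I_s =>
  [pick t : 'I_(N k) | (n0 ^ 2 + t == (n0 + x) ^ 2 + t0)%N]) => t k_t b_t.
have t0_t : (t0 <= t)%N by apply: t0_min; rewrite /T k_t.
have e : i + (t : nat)%:Z = i + t0%:Z + (t - t0)%N%:Z by rewrite -subzn //; ring.
have := @same_block k (i + t0%:Z) (t - t0)%N%:Z k0 b0.
rewrite -e => /(_ k_t b_t) rt.
have [n rn] := g_support b_t.
have sq : (n ^ 2 + t0 = n0 ^ 2 + t)%N.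
  have : (n ^ 2)%N%:Z = (n0 ^ 2)%N%:Z + (t - t0)%N%:Z.
    by rewrite -rn rt ?r0 //; have := ltn_ord t; lia.
  lia.
have n0_n : (n0 <= n)%N by rewrite -(@leq_exp2r _ _ 2) //; lia.
have n_lt : (n - n0 < s)%N.
  rewrite -(@ltn_exp2r _ _ 2) //; apply: leq_trans N_s; have := ltn_ord t.
  by move: sq; rewrite -(subnKC n0_n) addKn -!mulnn; nia.
(* The label [n - n0] determines [t]: [n ^ 2 - n0 ^ 2 = t - t0]. *)
exists (Ordinal n_lt) => /=; case: pickP => [t' /eqP|/(_ t)]; rewrite subnKC //.
  by rewrite sq => /addnI /val_inj ->.
by rewrite sq eqxx.
Qed.

(** A word is recovered from its position modulo [period k], which gives the letters
    of level below [k], and from the at most [s] other nonzero letters, recorded with their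
    places. *)
Lemma card_words_block_seq k s : (N k <= s ^ 2)%N ->
  (#|words block_seq (N k)| <= period k * (N k * #|A|).+1 ^ s)%N.
Proof.
move=> N_s; set L := N k.
pose decode (cf : 'I_(period k) * {ffun 'I_s -> option ('I_L * A)}) : L.-tuple A :=
  [tuple
    if (level ((cf.1 : nat)%:Z + (t : nat)%:Z)%R < k)%N
    then block_seq ((cf.1 : nat)%:Z + (t : nat)%:Z)
    else if [pick x | omap fst (cf.2 x) == Some t] is Some x
         then (if cf.2 x is Some ta then ta.2 else a0) else a0 | t < L].
apply: (@leq_trans #|decode @: [set: _]%SET|); last first.
  apply: leq_trans (leq_imset_card _ _) _.
  by rewrite cardsT card_prod card_ord card_ffun card_option card_prod !card_ord.
apply/subset_leq_card/fintype.subsetP => w.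
rewrite finset.in_set => /asboolP[i w_i]; apply/imsetP.
have [h h_cover] := window_cover i N_s.
have per0 : (period k)%:Z != 0 by rewrite gt_eqF // ltz_nat period_gt0.
have c_lt : (`|(i %% (period k)%:Z)%Z| < period k)%N.
  by rewrite -ltz_nat gez0_abs ?modz_ge0 // ltz_pmod // ltz_nat period_gt0.
exists (Ordinal c_lt,
  [ffun x => omap (fun t : 'I_L => (t, block_seq (i + (t : nat)%:Z))) (h x)]) => //.
apply: eq_from_tnth => t; rewrite tnth_mktuple w_i /= gez0_abs ?modz_ge0 //.
set q := (i %/ (period k)%:Z)%Z * (period k)%:Z.
have iE : i = (i %% (period k)%:Z)%Z + q by rewrite addrC -divz_eq.
have per_q : (period k %| `|q|)%N by rewrite abszM dvdn_mull.
set c := (i %% _)%Z in iE *.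
have it : i + (t : nat)%:Z = c + (t : nat)%:Z + q by rewrite {1}iE; ring.
have [lev|lev] := ltnP; first by rewrite it (block_seq_shift per_q lev).
have k_t : (k <= level (i + (t : nat)%:Z)%R)%N.
  rewrite leqNgt; apply/negP => lt; move: lev.
  have := level_shift (t := - q) _ lt; rewrite abszN {1}it addrK => /(_ per_q) ->.
  by rewrite leqNgt lt.
case: pickP => [x|none].
  rewrite ffunE; case: (h x) => //= t' /eqP[->] //.
apply/eqP; apply: contraT => b_t.
have [x hx] := h_cover t k_t b_t.
by have := none x; rewrite ffunE hx /= eqxx.
Qed.

Lemma has_entropy0_block_seq (R : realType) :
  has_entropy (orbit_closure block_seq) (0 : R).
Proof.
apply: has_entropy0 => d d_gt0.
pose M : R := (8 * (9 + #|A|))%:R.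
pose u0 := (Num.truncn (M / d)).+1.
pose k := (u0 ^ 4)%N; exists (N k) => //.
have k_le : (u0 ^ 4 <= N k)%N by apply/ltnW; exact: ltn_N.
have ex : exists t, (N k < t ^ 4)%N.
  by exists (N k).+1; rewrite -[leqLHS]expn1; apply: leq_pexp2l.
have [[|u] N_lt t_min] := ex_minnP ex; first by [].
have u_le : (u ^ 4 <= N k)%N.
  by rewrite leqNgt; apply/negP => /t_min; rewrite ltnn.
have u0_u : (u0 <= u)%N.
  by rewrite -ltnS -(@ltn_exp2r _ _ 4) // (leq_ltn_trans k_le).
have u_gt0 : (0 < u)%N by exact: leq_trans u0_u.
have N_s : (N k <= (u.+1 ^ 2) ^ 2)%N by rewrite -expnM ltnW.
have := card_words_block_seq N_s.
move/leq_trans => /(_ (N k * (N k * #|A|).+1 ^ (u.+1 ^ 2))%N).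
rewrite leq_mul2r period_le orbT => /(_ isT) /(ler_ln_nat R) /le_trans; apply.
have uR : 0 < u%:R :> R by rewrite ltr0n.
rewrite -(ler_pM2l uR); apply: le_trans (ln_sparse_le R _ u_gt0 _) _.
  by rewrite u_le.
rewrite mulrA ler_wpM2r ?ler0n // -ler_pdivrMr //.
rewrite -/M; apply: le_trans (ltW (truncnS_gt _)) _.
by rewrite ler_nat.
Qed.

Lemma near_multiple_nat j (m : nat) :
  near_multiple j m%:Z = ((m + reach j) %% P j <= 2 * reach j)%N.
Proof.
rewrite /near_multiple /residue -PoszD modz_nat lerBlDr -PoszD lez_nat.
by rewrite addnn mul2n.
Qed.

Lemma block_seq_square k n : (n <= N k)%N ->
  (forall j, (j < k)%N -> ~~ near_multiple j (n ^ 2)%N%:Z) ->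
  block_seq (n ^ 2)%N%:Z = g (n ^ 2)%N%:Z.
Proof.
move=> n_le far.
have small : `|(n ^ 2)%N%:Z| <= (reach k)%:Z.
  rewrite ger0_norm // lez_nat /reach.
  by rewrite (leq_trans _ (leq_addr _ _)) // leq_exp2r.
rewrite /block_seq; have -> : level (n ^ 2)%N%:Z = k.
  apply/eqP; rewrite eqn_leq; apply/andP; split.
    by apply: level_le; apply: near_multiple_small.
  rewrite leqNgt; apply/negP => /far; rewrite near_level //.
by rewrite residue_id.
Qed.

(** Since [P j <= N k], stage [j] spoils at most [(N k / P j + 1) (4 reach j + 2)] indices,
    and this is at most [2 N k / P j * (4 reach j + 2) <= N k / (K 2 ^ (j + 1))]. *)
Lemma count_near_multiple K k :
  (forall j, prime (P j)) ->
  (forall j, K * 2 ^ j.+2 * (2 * (2 * reach j + 1)) <= P j)%N ->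
  (K * \sum_(1 <= n < (N k).+1)
     [exists j : 'I_k, near_multiple j (n ^ 2)%N%:Z] <= N k)%N.
Proof.
move=> P_pr P_ge.
apply: (@leq_trans (K * \sum_(0 <= j < k) \sum_(1 <= n < (N k).+1)
    ((n ^ 2 + reach j) %% P j <= 2 * reach j))%N).
  rewrite leq_mul2l exchange_big /=; apply/orP; right; apply: leq_sum => n _.
  case: existsP => // -[j]; rewrite near_multiple_nat => j_n.
  by rewrite big_mkord (bigD1 j) //= j_n.
rewrite big_distrr /=.
have P_le j : (j < k)%N -> (P j <= N k)%N.
  move=> jk; apply: leq_trans (period_le k); apply: dvdn_leq; last exact: dvd_period.
  exact: period_gt0.
rewrite (@leq_trans (\sum_(0 <= j < k) if (j < k)%N then K * ((N k %/ P j).+1 * (2 * (2 * reach j + 1))) else 0)%N) //.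
  rewrite big_nat [leqRHS]big_nat; apply: leq_sum => j /= jk.
  by rewrite jk leq_mul2l count_near ?orbT.
apply: sum_geometric_le => j; case: ltnP => jk; last by rewrite muln0.
have h1 := P_ge j; have h2 := P_le j jk; have h3 := leq_trunc_div (N k) (P j).
have h4 := leq_mul (leqnn (N k %/ P j).+1) h1.
move: h4 h3; rewrite mulSn expnS; nia.
Qed.

End BlockSequence.

(** * Choice of the scales and conclusion *)

(** The choices alternate, [N k] depending on the primes [P j] with [j < k] through their
    product only; hence a single recursion on this product yields both sequences. *)
Lemma exists_scales (K : nat) (good : nat -> Prop) : (0 < K)%N ->
  (forall M, exists2 n, (M <= n)%N & good n) ->
  exists N P : nat -> nat, forall k,
    [/\ (0 < N k)%N, good (N k), (period P k <= N k)%N, prime (P k) &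
        (K * 2 ^ k.+2 * (2 * (2 * reach N k + 1)) <= P k)%N].
Proof.
move=> K_gt0 freq.
pose nextN m := s2val (cid2 (freq m.+1)).
have nextN_gt m : (m < nextN m)%N by exact: s2valP (cid2 (freq m.+1)).
have nextN_good m : good (nextN m) by exact: s2valP' (cid2 (freq m.+1)).
pose nextP k n := s2val (prime_above (K * 2 ^ k.+2 * (2 * (2 * (n ^ 2 + n) + 1)))).
pose per := fix per k := if k is j.+1 then (per j * nextP j (nextN (per j)))%N else 1%N.
exists (fun k => nextN (per k)), (fun k => nextP k (nextN (per k))) => k.
split=> //.
- exact: leq_ltn_trans (nextN_gt _).
- suff -> : period (fun k => nextP k (nextN (per k))) k = per k by exact: ltnW.
  by elim: k => [|k IHk]; rewrite /period ?big_ord0 // big_ord_recr /= -IHk.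
- exact: s2valP' (prime_above _).
- exact: ltnW (s2valP (prime_above _)).
Qed.

Lemma limn_esup_ge (R : realType) (u : nat -> R) (c : R) :
  (forall M, exists2 n, (M <= n)%N & c <= u n) ->
  (c%:E <= limn_esup (fun n => (u n)%:E))%E.
Proof.
move=> freq; apply: le_ereal_inf_tmp => _ [V [M _ MV] <-].
have [n Mn c_n] := freq M.
by apply: le_ereal_sup_tmp; exists (u n)%:E; rewrite ?lee_fin //; exists n => //; apply: MV.
Qed.

Definition at_square (A : Type) (a0 : A) (f : nat -> A) (m : int) : A :=
  if m is Posz q then
    if [pick n : 'I_q.+1 | (n ^ 2 == q)%N] is Some n then f n else a0
  else a0.

Lemma at_square_sqr (A : Type) (a0 : A) (f : nat -> A) (n : nat) :
  at_square a0 f (n ^ 2)%N%:Z = f n.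
Proof.
rewrite /at_square; case: pickP => [m /eqP e|].
  by congr f; apply/eqP; rewrite -(eqn_exp2r _ _ (isT : 0 < 2)%N) e.
have n_lt : (n < (n ^ 2).+1)%N by rewrite -mulnn; nia.
by move=> /(_ (Ordinal n_lt)); rewrite eqxx.
Qed.

Lemma at_square_support (A : eqType) (a0 : A) (f : nat -> A) (m : int) :
  at_square a0 f m != a0 -> exists n : nat, m = (n ^ 2)%N%:Z.
Proof.
case: m => q /=; last by rewrite eqxx.
by case: pickP => [n /eqP e _|]; [exists n; rewrite e | rewrite eqxx].
Qed.

(** On the exceptional set [v n * mu n] is at least [-1], which is at least [mu n ^ 2 - 2]. *)
Lemma sum_agree_off (R : realType) (M : nat) (v mu : nat -> R) (B : nat -> bool) :
  (forall n, `|v n| <= 1) -> (forall n, `|mu n| <= 1) ->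
  (forall n, (n <= M)%N -> ~~ B n -> v n = mu n) ->
  \sum_(1 <= n < M.+1) mu n ^+ 2 - 2 * (\sum_(1 <= n < M.+1) B n)%:R
    <= \sum_(1 <= n < M.+1) v n * mu n.
Proof.
move=> v1 mu1 vmu; rewrite natr_sum big_distrr /= -sumrB; apply: ler_sum_nat.
move=> n /andP[_ n_M]; case: (boolP (B n)) => [_|/vmu ->] //; last first.
  by rewrite mulr0 subr0 expr2.
have h : `|v n * mu n| <= 1 by rewrite normrM mulr_ile1.
have h2 : mu n ^+ 2 <= 1 by rewrite -real_normK ?num_real // expr_le1.
by move: h; rewrite ler_norml mulr1 => /andP[]; lra.
Qed.

Theorem theorem1p1 (R : realType) (eps : R) (heps : 0 < eps) :
  exists (S : {fset R}) (b : biseq S),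
    [/\ toeplitz b,
        has_entropy (orbit_closure b) (0 : R) &
        ((6 / pi ^+ 2 - eps)%:E <
         limn_esup (fun N : nat =>
           (N%:R^-1 * `|\sum_(1 <= n < N.+1)
              fsval (b (n ^ 2)%N%:Z) * (moebius n)%:~R|)%:E))%E].
Proof.
(* The density costs [eps / 3] and the spoiled indices [2 / K < eps / 3]; what is left of
   [eps] makes the inequality strict. *)
pose c : R := 6 / pi ^+ 2 - eps / 3.
have freq M : exists2 n, (M <= n)%N & c * n%:R <= (squarefree_count n)%:R.
  by apply: exists_squarefree_count; rewrite /c; lra.
pose K := (Num.truncn (6 / eps)).+1.
have [N [P scales]] := exists_scales (ltn0Sn (Num.truncn (6 / eps))) freq.
have N_gt0 k : (0 < N k)%N by case: (scales k).
have period_le k : (period P k <= N k)%N by case: (scales k).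
have P_pr k : prime (P k) by case: (scales k).
have P_ge k : (K * 2 ^ k.+2 * (2 * (2 * reach N k + 1)) <= P k)%N by case: (scales k).
have P_gt k : (2 * reach N k < P k)%N.
  apply: leq_trans (P_ge k); have := expn_gt0 2 k.+2.
  by move: (2 ^ _)%N => p p_gt0; rewrite -mulnA /K mulSn; nia.
pose S : {fset R} := [fset -1; 0; 1]%fset.
have S_unit (x : S) : `|fsval x| <= 1.
  have := valP x; rewrite !inE -orbA => /or3P[] /eqP ->;
    by rewrite ?normrN ?normr0 ?normr1.
have S0 : 0 \in S by rewrite !inE eqxx orbT.
have S_mu n : (moebius n)%:~R \in S.
  by have [->|[->|->]] := moebius_unit n; rewrite !inE ?eqxx ?orbT.
pose zero : S := [` S0]%fset.
pose g := at_square zero (fun n => [` S_mu n]%fset).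
have g_support := @at_square_support _ zero (fun n => [` S_mu n]%fset).
exists S, (block_seq g N P); split.
- exact: toeplitz_block_seq.
- exact: (has_entropy0_block_seq N_gt0 period_le P_gt g_support).
apply: (@lt_le_trans _ _ (c - 2 / K%:R)%:E).
  rewrite lte_fin /c; have := truncnS_gt (6 / eps); rewrite -/K => K_gt.
  have K0 : 0 < K%:R :> R by rewrite ltr0n.
  have : 2 / K%:R < eps / 3; last by lra.
  by rewrite ltr_pdivrMr //; move: K_gt; rewrite ltr_pdivrMr //; lra.
apply: limn_esup_ge => k; exists (N k).
  by apply/ltnW/(ltn_N N_gt0 period_le P_gt).
have NR : 0 < (N k)%:R :> R by rewrite ltr0n.
rewrite [leRHS]mulrC ler_pdivlMr //; apply: le_trans (ler_norm _).
pose B n := [exists j : 'I_k, near_multiple N P j (n ^ 2)%N%:Z].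
have := @sum_agree_off R (N k) (fun n => fsval (block_seq g N P (n ^ 2)%N%:Z))
  (fun n => (moebius n)%:~R) B.
have mu1 n : `|(moebius n)%:~R : R| <= 1 by exact: (S_unit [` S_mu n]%fset).
have agree n : (n <= N k)%N -> ~~ B n ->
    fsval (block_seq g N P (n ^ 2)%N%:Z) = (moebius n)%:~R.
  move=> n_N; rewrite negb_exists => /forallP far.
  rewrite (block_seq_square g N_gt0 period_le P_gt n_N); first by rewrite /g at_square_sqr.
  by move=> j jk; exact: far (Ordinal jk).
move=> /(_ (fun n => S_unit _) mu1 agree); apply: le_trans.
have -> : \sum_(1 <= n < (N k).+1) ((moebius n)%:~R : R) ^+ 2 =
    (squarefree_count (N k))%:R.
  rewrite natr_sum; apply: eq_bigr => n _.
  by rewrite expr2 -intrM moebius_sqr; case: squarefree.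
have good : c * (N k)%:R <= (squarefree_count (N k))%:R by case: (scales k).
have := count_near_multiple period_le P_gt k P_pr P_ge.
rewrite -/B -(ler_nat R) natrM => lost.
have K0 : 0 < K%:R :> R by rewrite ltr0n.
have {lost} : (\sum_(1 <= n < (N k).+1) B n)%:R <= (N k)%:R / K%:R :> R.
  by rewrite ler_pdivlMr // mulrC.
lra.
Qed.
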